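(* Let $G$ be a hyper group, $M$ and $N$ normal sub hyper groups of $G$, with $N$ a sub hyper group of $M$. Then for each $e\in\mathbf e_N$ (the identity set of $N$): (i) $M_e/N_e$ is a normal subgroup of $G_e/N_e$; (ii) $(G_e/N_e)/(M_e/N_e)\cong G_e/M_e$.
   Context: Hyper group: Let $(G,* )$ be a semigroup. A subset $\mathbf e\subset G$ is an identity set if (i) $g*e=e*g$ for all $g\in G$, $e\in\mathbf e$; (ii) $\mathbf e=\{e_\lambda:\lambda\in\Lambda\}$ is indexed without repetition by a lattice $(\Lambda,\le)$ and $e_\lambda*e_\mu=e_{\lambda\vee\mu}$; (iii) for each $g\in G$ there is a unique $e_g=e_{\lambda_g}\in\mathbf e$ such that for all $\lambda\in\Lambda$: $e_\lambda*g=g$ if and only if $\lambda\le\lambda_g$. A hyper group $(G,*,\mathbf e)$ is a semigroup with an identity set such that for each $g\in G$ there is $g^{-1}\in G$ with $g*g^{-1}=g^{-1}*g=e_g$. For $e\in\mathbf e$, the component group is $G_e=\{x\in G: e_x=e\}$, a group under $*$ with identity $e$. Sub hyper group of $(G,*,\mathbf e)$: a hyper group $(H,*,\mathbf e_H)$ with $H\subset G$ and $\mathbf e_H\subset\mathbf e$ a sublattice; $H_e=\{h\in H:e_h=e\}$ for $e\in\mathbf e_H$. It is normal if $gH_{e_g}=H_{e_g}g$ for all $g\in G$ with $e_g\in\mathbf e_H$. *)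

(* Defs.v *)
From HB Require Import structures.
From mathcomp Require Import all_boot all_order.
From mathcomp Require Import boolp classical_sets functions.

Set Implicit Arguments.
Unset Strict Implicit.
Unset Printing Implicit Defensive.

Import Order.TTheory.

Local Open Scope classical_set_scope.
Local Open Scope group_scope.

(* Groups are handled as subsets of an ambient semigroup: a component group
   lives in the semigroup underlying a hyper group, and a group of cosets lives
   in the semigroup of subsets, under the pointwise product defined next. *)

Section SetProduct.
Context (S : semigroupType).
Implicit Types A B C : set S.

Definition set_mulg A B : set S := [set x * y | x in A & y in B].

Lemma set_mulgA : associative set_mulg.
Proof.
move=> A B C; apply/seteqP; split=> t.
- move=> [x Ax [_ [y By [z Cz <-]] <-]].
  by exists (x * y); [exists x => //; exists y | exists z; rewrite ?mulgA].
- move=> [_ [x Ax [y By <-]] [z Cz <-]]; exists x => //.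
  by exists (y * z); [exists y => //; exists z | rewrite mulgA].
Qed.

HB.instance Definition _ := isSemigroup.Build (set S) set_mulgA.

End SetProduct.

Section GroupsInSemigroups.
Context (S : semigroupType).
Implicit Types A H : set S.

Record is_group A : Prop := IsGroup {
  is_group_mul : forall x y, A x -> A y -> A (x * y);
  is_group_unit_inv : exists2 u, A u &
    (forall x, A x -> u * x = x /\ x * u = x) /\
    (forall x, A x -> exists2 y, A y & x * y = u /\ y * x = u) }.

Definition lcos (x : S) H : set S := [set x * h | h in H].
Definition rcos H (x : S) : set S := [set h * x | h in H].

Record normal_subgroup H A : Prop := NormalSubgroup {
  normal_subgroup_group : is_group A;
  normal_subgroup_subgroup : is_group H;
  normal_subgroup_sub : H `<=` A;
  normal_subgroup_coset : forall x, A x -> lcos x H = rcos H x }.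

(* The product of two cosets is their product as subsets; this is the usual
   quotient group when H is a normal subgroup of A. *)
Definition quotient_group A H : set (set S) := [set lcos x H | x in A].

End GroupsInSemigroups.

Record isomorphic (S T : semigroupType) (A : set S) (B : set T) : Prop :=
  Isomorphic {
    isomorphic_groupl : is_group A;
    isomorphic_groupr : is_group B;
    isomorphic_map : exists2 f : S -> T, set_bij A B f &
      forall x y, A x -> A y -> f (x * y) = f x * f y }.

Section HyperGroups.
Context (S : semigroupType) (d : Order.disp_t) (L : latticeType d) (e : L -> S).
Implicit Types (A B : set S) (I J : set L).

Definition sublattice I : Prop :=
  forall l m, I l -> I m -> I (l `|` m)%O /\ I (l `&` m)%O.

(* e_g = e l, computed with respect to the identity set { e m | m in I } *)
Definition identity_of I (g : S) (l : L) : Prop :=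
  I l /\ forall m, I m -> (e m * g = g <-> (m <= l)%O).

(* { e l | l in I } is an identity set of the semigroup A.  A hyper group
   together with its sub hyper groups is described by a single family e over
   the lattice L; the hyper group itself has A = setT and I = setT. *)
Record identity_set A I : Prop := IdentitySet {
  identity_set_lattice : sublattice I;
  identity_set_sub : forall l, I l -> A (e l);
  identity_set_comm : forall g l, A g -> I l -> g * e l = e l * g;
  identity_set_inj : set_inj I e;
  identity_set_join : forall l m, I l -> I m -> e l * e m = e (l `|` m)%O;
  identity_set_uniq : forall g, A g -> exists! l, identity_of I g l }.

Record hyper_group A I : Prop := HyperGroup {
  hyper_group_mul : forall x y, A x -> A y -> A (x * y);
  hyper_group_identity : identity_set A I;
  hyper_group_inv : forall g l, A g -> identity_of I g l ->
    exists2 h, A h & g * h = e l /\ h * g = e l }.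

Record sub_hyper_group B J A I : Prop := SubHyperGroup {
  sub_hyper_group_hyper : hyper_group B J;
  sub_hyper_group_sub : B `<=` A;
  sub_hyper_group_identity : J `<=` I }.

Definition component A I (l : L) : set S := [set x | A x /\ identity_of I x l].

Record normal_sub_hyper_group B J A I : Prop := NormalSubHyperGroup {
  normal_sub_hyper_group_sub : sub_hyper_group B J A I;
  normal_sub_hyper_group_coset : forall g l, A g -> identity_of I g l -> J l ->
    lcos g (component B J l) = rcos (component B J l) g }.

End HyperGroups.

(* Main.v *)
Require Import Defs.
From mathcomp Require Import all_boot all_order.
From mathcomp Require Import boolp classical_sets functions.

(** At a fixed identity, the statement is the third isomorphism theorem for
    ordinary groups, so the proof has two independent halves.

    Passing from hyper groups to groups.  Every component of a hyper group is a
    group ([component_group]).  The identity of an element could a priori depend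
    on whether it is computed in the hyper group or in a sub hyper group, where
    fewer idempotents are tested.  It does not: if [e l] is the identity of [g]
    in the smaller one and [e m] in the larger one, then [l <= m], and
    multiplying [e m * g = g] by an inverse of [g] taken in the smaller one
    yields [e (m `|` l) = e l], so [m <= l] ([component_sub]).  Hence
    [N_e `<=` M_e `<=` G_e], and the normality of [M] and [N] specialises to
    normality of these subgroups.

    Third isomorphism theorem.  Since products of cosets are products of sets,
    [x |-> lcos x K] is multiplicative ([lcosM]), and [A / K] and [H / K] are
    the images of [A] and [H] under it.  A multiplicative map sends normal
    subgroups to normal subgroups of the image ([image_normal]); this is (i).
    For (ii), a coset of [H / K] is the collection of the [K]-cosets that
    partition a coset of [H].  Its union is therefore that coset of [H], which
    in turn determines the collection.  The isomorphism is thus the union map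
    [X |-> \bigcup_(C in X) C], with inverse [B |-> [set lcos b K | b in B]]. *)

Set Implicit Arguments.
Unset Strict Implicit.
Unset Printing Implicit Defensive.

Import Order.TTheory.

Local Open Scope classical_set_scope.
Local Open Scope group_scope.

Definition multiplicative_on (S T : semigroupType) (A : set S) (f : S -> T) :=
  forall x y, A x -> A y -> f (x * y) = f x * f y.

Section CosetMaps.
Context (S : semigroupType).
Implicit Types A H K : set S.

(** The unit of [H] is an idempotent of [A], and the only idempotent of a group
    is its unit. *)
Lemma subgroup_unit A H : is_group A -> is_group H -> H `<=` A ->
  exists2 u, H u & forall x, A x -> x * u = x.
Proof.
move=> [_ [v _ [v1 vV]]] [_ [u Hu [u1 _]]] HA; exists u => //.
suff -> : u = v by move=> x /v1[].
have [w _ [_ wu]] := vV u (HA u Hu).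
by rewrite -(proj1 (v1 u (HA u Hu))) -{1}wu -mulgA (proj1 (u1 u Hu)).
Qed.

Lemma image_group (T : semigroupType) A (f : S -> T) :
  multiplicative_on A f -> is_group A -> is_group (f @` A).
Proof.
move=> fM [AM [u Au [u1 uV]]]; split.
  move=> _ _ [x Ax <-] [y Ay <-]; rewrite -fM //.
  by exists (x * y) => //; exact: AM.
exists (f u); first by exists u.
split=> _ [x Ax <-].
  by rewrite -!fM //; have [-> ->] := u1 x Ax.
have [y Ay [xy yx]] := uV x Ax.
by exists (f y); [exists y | rewrite -!fM // xy yx].
Qed.

Lemma lcos_image (T : semigroupType) A H (f : S -> T) x :
  multiplicative_on A f -> H `<=` A -> A x ->
  lcos (f x) (f @` H) = f @` lcos x H.
Proof.
move=> fM HA Ax; apply/seteqP; split=> t.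
  move=> [_ [h Hh <-] <-]; exists (x * h); first by exists h.
  by rewrite fM //; exact: HA.
move=> [_ [h Hh <-] <-]; exists (f h); first by exists h.
by rewrite fM //; exact: HA.
Qed.

Lemma rcos_image (T : semigroupType) A H (f : S -> T) x :
  multiplicative_on A f -> H `<=` A -> A x ->
  rcos (f @` H) (f x) = f @` rcos H x.
Proof.
move=> fM HA Ax; apply/seteqP; split=> t.
  move=> [_ [h Hh <-] <-]; exists (h * x); first by exists h.
  by rewrite fM //; exact: HA.
move=> [_ [h Hh <-] <-]; exists (f h); first by exists h.
by rewrite fM //; exact: HA.
Qed.

Lemma image_normal (T : semigroupType) A H (f : S -> T) :
  multiplicative_on A f -> normal_subgroup H A ->
  normal_subgroup (f @` H) (f @` A).
Proof.
move=> fM [gA gH HA nH]; split.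
- exact: image_group.
- by apply: image_group => // x y Hx Hy; apply: fM; exact: HA.
- exact: image_subset.
- move=> _ [x Ax <-].
  by rewrite (lcos_image fM) // (rcos_image fM) // nH.
Qed.

(** In [xH yH], normality moves [H] past [y]; the unit of [H] gives the
    converse inclusion. *)
Lemma lcosM A H : normal_subgroup H A ->
  multiplicative_on A (fun x => lcos x H).
Proof.
move=> [gA gH HA nH] x y Ax Ay; apply/seteqP; split=> t.
  move=> [h Hh <-]; have [u Hu u1] := subgroup_unit gA gH HA.
  exists (x * u); first by exists u.
  by exists (y * h); [exists h | rewrite u1 // mulgA].
move=> [_ [h Hh <-] [_ [k Hk <-] <-]].
have : rcos H y (h * y) by exists h.
rewrite -nH // => -[h' Hh' hy].
exists (h' * k); first exact: is_group_mul.
by rewrite -!mulgA; congr (_ * _); rewrite !mulgA hy.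
Qed.

Lemma quotient_is_group A H :
  normal_subgroup H A -> is_group (quotient_group A H).
Proof. by move=> nH; apply: image_group (lcosM nH) _; case: nH. Qed.

(** [K]-cosets meeting [xH] lie inside [xH], because [K] lies in [H], and they
    cover it, because [K] has the unit of [A]. *)
Lemma bigcup_lcos A H K x : is_group A -> is_group H -> is_group K ->
  K `<=` H -> H `<=` A -> A x ->
  \bigcup_(C in [set lcos b K | b in lcos x H]) C = lcos x H.
Proof.
move=> gA gH gK KH HA Ax; apply/seteqP; split=> t.
  move=> [_ [_ [h Hh <-] <-] [k Kk <-]].
  exists (h * k); last by rewrite mulgA.
  by apply: is_group_mul => //; exact: KH.
move=> xHt; exists (lcos t K); first by exists t.
have [u Ku u1] := subgroup_unit gA gK (subset_trans KH HA).
exists u => //; apply: u1.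
by case: xHt => h Hh <-; apply: is_group_mul => //; exact: HA.
Qed.

Lemma quotient_normal A H K : normal_subgroup H A -> normal_subgroup K A ->
  normal_subgroup (quotient_group H K) (quotient_group A K).
Proof. by move=> nH nK; exact: image_normal (lcosM nK) nH. Qed.

End CosetMaps.

(** A coset of [H / K] is the image of a coset [xH] under [b |-> lcos b K], and
    its union is [xH] again; this makes the union map injective. *)
Lemma third_isomorphism (S : semigroupType) (A H K : set S) :
  normal_subgroup H A -> normal_subgroup K A -> K `<=` H ->
  isomorphic (quotient_group (quotient_group A K) (quotient_group H K))
             (quotient_group A H).
Proof.
move=> nH nK KH; have nHK := quotient_normal nH nK.
have [gA gH HA _] := nH; have [_ gK _ _] := nK.
pose coset (x : S) := lcos x K.
have cosetE x : A x -> lcos (coset x) (quotient_group H K) = coset @` lcos x H.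
  exact: lcos_image (lcosM nK) HA.
have unionE x : A x ->
    \bigcup_(C in lcos (coset x) (quotient_group H K)) C = lcos x H.
  by move=> Ax; rewrite cosetE //; exact: bigcup_lcos gA gH gK KH HA Ax.
split; [exact: quotient_is_group|exact: quotient_is_group|].
exists (fun X : set (set S) => \bigcup_(C in X) C); first split.
- by move=> _ [_ [x Ax <-] <-]; rewrite unionE //; exists x.
- move=> X Y /set_mem[_ [x Ax <-] <-] /set_mem[_ [y Ay <-] <-].
  by rewrite !unionE // !cosetE // => ->.
- move=> _ [x Ax <-]; exists (lcos (coset x) (quotient_group H K)).
    by exists (coset x) => //; exists x.
  exact: unionE.
- move=> _ _ [_ [x Ax <-] <-] [_ [y Ay <-] <-].
  rewrite -(lcosM nHK); [|by exists x|by exists y].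
  have cosetM : coset x * coset y = coset (x * y) by rewrite /coset (lcosM nK).
  rewrite [X in lcos X _]cosetM !unionE //; first exact: (lcosM nH).
  exact: is_group_mul.
Qed.

Section Components.
Context (S : semigroupType) (d : Order.disp_t) (L : latticeType d) (e : L -> S).
Implicit Types (A B : set S) (I J : set L).

Lemma identity_mul_eq A I l m : identity_set e A I -> I l -> I m ->
  e m * e l = e l <-> (m <= l)%O.
Proof.
move=> iA Il Im; rewrite (identity_set_join iA) //; split=> [eml|]; last first.
  by rewrite leEjoin => /eqP ->.
have Iml := proj1 (identity_set_lattice iA Im Il).
rewrite leEjoin; apply/eqP.
by apply: (identity_set_inj iA) => //; exact/mem_set.
Qed.

Lemma component_group A I l :
  hyper_group e A I -> I l -> is_group (component e A I l).
Proof.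
move=> [AM iA AV] Il; have idE m := @identity_mul_eq A I l m iA Il.
have Ael := identity_set_sub iA Il.
have el1 x : component e A I l x -> e l * x = x.
  by move=> [_ [_ xl]]; apply/(xl l Il).
have el1r x : component e A I l x -> x * e l = x.
  by move=> Cx; rewrite (identity_set_comm iA) ?el1 //; case: Cx.
split.
- move=> x y Cx [Ay yl]; have [Ax [_ xl]] := Cx.
  split; [exact: AM|split=> // m Im].
  split=> [mxy|/(xl m Im) mx]; last by rewrite mulgA mx.
  have [h _ [yh _]] := AV y l Ay yl.
  apply/(xl m Im); rewrite -(el1r x) // -yh mulgA mulgA.
  by rewrite -[e m * x * y]mulgA mxy mulgA.
- exists (e l); first by split=> //; split=> // m Im; exact: idE.
  split=> x Cx; first by rewrite el1 ?el1r.
  have [Ax xl] := Cx; have [h Ah [xh hx]] := AV x l Ax xl.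
  have elel : e l * e l = e l by apply/idE.
  have hxl : h * e l * x = e l by rewrite -mulgA el1.
  (* The inverse h is only known to lie in A: the index of its own
     identity may be strictly below l.  Multiplying by e l moves h into the
     component of x. *)
  exists (h * e l); last by rewrite mulgA xh elel.
  split; first exact: AM.
  split=> // m Im; split=> [mh|ml].
    by apply/(idE m Im); rewrite -hxl mulgA mh.
  rewrite (identity_set_comm iA Ah Il) mulgA.
  by move/(idE m Im): ml => ->.
Qed.

(** The inverse of [x] in [B] turns an idempotent fixing [x] into one fixing
    [e l], so testing the additional idempotents of [I] does not enlarge the
    identity of [x]. *)
Lemma component_sub B J A I l : hyper_group e A I -> sub_hyper_group e B J A I ->
  component e B J l `<=` component e A I l.
Proof.
move=> [_ iA _] [[_ _ BV] BA JI] x [Bx xl]; split; first exact: BA.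
have [Jl xJ] := xl; have Il := JI l Jl.
split=> // m Im; rewrite -(identity_mul_eq iA Il Im); split=> mx.
  have [h _ [xh _]] := BV x l Bx xl.
  by rewrite -xh mulgA mx.
by have <- : e l * x = x; [apply/(xJ l Jl) | rewrite mulgA mx].
Qed.

Lemma component_normal B J A I l : hyper_group e A I ->
  normal_sub_hyper_group e B J A I -> J l ->
  normal_subgroup (component e B J l) (component e A I l).
Proof.
move=> hA [sB nB] Jl; have [hB _ JI] := sB; split.
- by apply: component_group => //; exact: JI.
- exact: component_group.
- exact: component_sub.
- by move=> x [Ax xl]; exact: nB.
Qed.

End Components.

Theorem theorem5p9 (S : semigroupType) (d : Order.disp_t) (L : latticeType d)
    (e : L -> S) (M N : set S) (LM LN : set L)
    (hG : hyper_group e setT setT)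
    (nM : normal_sub_hyper_group e M LM setT setT)
    (nN : normal_sub_hyper_group e N LN setT setT)
    (sNM : sub_hyper_group e N LN M LM)
    (l : L) (hl : LN l) :
  let G_e := component e setT setT l in
  let M_e := component e M LM l in
  let N_e := component e N LN l in
  normal_subgroup (quotient_group M_e N_e) (quotient_group G_e N_e) /\
  isomorphic (quotient_group (quotient_group G_e N_e) (quotient_group M_e N_e))
             (quotient_group G_e M_e).
Proof.
move=> G_e M_e N_e.
have nMe : normal_subgroup M_e G_e.
  by apply: component_normal => //; case: sNM => _ _; exact.
have nNe : normal_subgroup N_e G_e by exact: component_normal.
have NMe : N_e `<=` M_e.
  by apply: component_sub sNM; case: nM => -[].
by split; [exact: quotient_normal | exact: third_isomorphism].
Qed.
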